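(* Let $m,d\ge 2$ and $n$ be integers with $d\in\{2n-1,2n\}$, and let $X_1,\dots,X_m\in\mathbb M_d(\mathbb C)$. If $\left|\sum_{j=1}^m X_j\right|\ge I_d$, then $$\lambda_n\left(\sum_{j=1}^m |X_j|_{\mathrm{sym}}\right)\ge\frac12 .$$ Moreover, for every $m\ge2$ the constant $1/2$ is optimal both for $(d,n)=(3,2)$ and for $(d,n)=(6,3)$: for each $(d,n)\in\{(3,2),(6,3)\}$, each $m\ge 2$ and each real $c>1/2$, there exist $X_1,\dots,X_m\in\mathbb M_d(\mathbb C)$ with $\left|\sum_{j=1}^m X_j\right|\ge I_d$ and $\lambda_n\left(\sum_{j=1}^m |X_j|_{\mathrm{sym}}\right)<c$.
   Context: $\mathbb M_d(\mathbb C)$ is the algebra of complex $d\times d$ matrices and $I_d$ its identity. $|X|=(X^*X)^{1/2}$, and the symmetric modulus is $|X|_{\mathrm{sym}}=\frac{|X|+|X^*|}{2}$. For Hermitian $T\in\mathbb M_d(\mathbb C)$, $\lambda_1(T)\ge\cdots\ge\lambda_d(T)$ are its eigenvalues counted with multiplicity in nonincreasing order. $S\le T$ (equivalently $T\ge S$) for Hermitian matrices means $T-S$ is positive semidefinite. *)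

(* Defs.v *)
From HB Require Import structures.
From mathcomp Require Import all_boot all_order all_algebra.
From mathcomp Require Import reals.
From mathcomp Require Import complex.

Set Implicit Arguments.
Unset Strict Implicit.
Unset Printing Implicit Defensive.

Import Order.TTheory GRing.Theory Num.Theory.
Local Open Scope ring_scope.
Local Open Scope complex_scope.
Local Open Scope sesquilinear_scope.

(* In [R[i]], [0 <= z] means that [z] is real and nonnegative. *)
Definition psdmx (R : realType) (d : nat) (A : 'M[R[i]]_d) : Prop :=
  A \is hermsymmx /\ forall v : 'cV[R[i]]_d, 0 <= (v^t* *m A *m v) 0 0.

Definition loewner_le (R : realType) (d : nat) (S T : 'M[R[i]]_d) : Prop :=
  psdmx (T - S).

(* Square root by unitary diagonalization; meaningful for positive
   semidefinite [A], see [sqrtmx_psd] and [sqrtmxK] below. *)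
Definition sqrtmx (R : realType) (d : nat) (A : 'M[R[i]]_d) : 'M[R[i]]_d :=
  invmx (spectralmx A) *m diag_mx (map_mx sqrtC (spectral_diag A))
    *m spectralmx A.

Definition modulus (R : realType) (d : nat) (X : 'M[R[i]]_d) : 'M[R[i]]_d :=
  sqrtmx (X^t* *m X).

Definition sym_modulus (R : realType) (d : nat) (X : 'M[R[i]]_d) :
    'M[R[i]]_d :=
  2^-1 *: (modulus X + modulus (X^t*)).

(* For Hermitian [T] the entries of [spectral_diag T] are the eigenvalues with
   multiplicity; they are real, so taking real parts only changes their type. *)
Definition eigvals (R : realType) (d : nat) (T : 'M[R[i]]_d) : seq R :=
  sort >=%R [seq complex.Re (spectral_diag T 0 i) | i : 'I_d].

(* Indexed from 1: [lambda 1 T] is the largest eigenvalue.  The index [k] is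
   meant to satisfy [1 <= k <= d]. *)
Definition lambda (R : realType) (k d : nat) (T : 'M[R[i]]_d) : R :=
  (eigvals T)`_(k.-1).

Section SpectralSanity.

Variables (R : realType) (d : nat).
Implicit Types A X : 'M[R[i]]_d.

Lemma trmxC_mul m n p (A : 'M[R[i]]_(m, n)) (B : 'M_(n, p)) :
  (A *m B)^t* = B^t* *m A^t*.
Proof. by rewrite trmx_mul map_mxM. Qed.

Lemma hermsymmxP A : reflect (A^t* = A) (A \is hermsymmx).
Proof.
by rewrite is_hermitianmxE expr0 scale1r eq_sym; apply: eqP.
Qed.

Lemma gram_ge0 m (P : 'M[R[i]]_(m, d)) (D : 'rV_m) (v : 'cV[R[i]]_d) :
  (forall i, 0 <= D 0 i) ->
  0 <= (v^t* *m (P^t* *m diag_mx D *m P) *m v) 0 0.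
Proof.
move=> D_ge0.
rewrite !mulmxA -trmxC_mul -mulmxA mxE; apply: sumr_ge0 => k _.
rewrite mul_mx_diag !mxE mulrAC [_^* * _]mulrC.
by rewrite mulr_ge0 // mul_conjC_ge0.
Qed.

Lemma psdmx_gram X : psdmx (X^t* *m X).
Proof.
split=> [|v]; first by apply/hermsymmxP; rewrite trmxC_mul trmxCK.
rewrite -[X^t*]mulmx1.
have := @gram_ge0 d X (const_mx 1) v.
rewrite diag_const_mx => -> // i.
by rewrite mxE ler01.
Qed.

Lemma spectral_diag_psd A i : psdmx A -> 0 <= spectral_diag A 0 i.
Proof.
case=> hA /(_ ((spectralmx A)^t* *m delta_mx i 0)).
have /hermitian_normalmx /orthomx_spectralP := hA.
have uP := spectral_unitarymx A; have Pu := spectral_unit A.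
rewrite -(invmx_unitary uP).
move: (spectralmx A) (spectral_diag A) uP Pu => P D uP Pu ->.
rewrite trmxC_mul (invmx_unitary uP) trmxCK -(invmx_unitary uP) !mulmxA.
rewrite !mulmxK //.
rewrite mul_mx_diag mxE (bigD1 i) //= big1 => [|k ki]; last first.
  by rewrite !mxE (negPf ki) mulr0.
by rewrite !mxE !eqxx /= conjC1 mul1r mulr1 addr0.
Qed.

Lemma sqrtmx_psd A : psdmx A -> psdmx (sqrtmx A).
Proof.
move=> psdA; have D_ge0 i := spectral_diag_psd i psdA.
have sD_ge0 i : 0 <= map_mx sqrtC (spectral_diag A) 0 i.
  by rewrite mxE sqrtC_ge0.
rewrite /sqrtmx (invmx_unitary (spectral_unitarymx A)).
split=> [|v]; last exact: gram_ge0.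
apply/hermsymmxP; rewrite !trmxC_mul trmxCK mulmxA.
congr (_ *m _ *m _); apply/matrixP => i j.
rewrite !mxE eq_sym; case: eqP => [->|_]; last by rewrite !mulr0n conjC0.
rewrite !mulr1n; apply/CrealP/ger0_real; rewrite sqrtC_ge0; exact: D_ge0.
Qed.

Lemma sqrtmxK A : psdmx A -> sqrtmx A *m sqrtmx A = A.
Proof.
case=> /hermitian_normalmx /orthomx_spectralP eA _.
rewrite {3}eA /sqrtmx -!mulmxA (mulKVmx (spectral_unit A)).
congr (_ *m _); rewrite !mulmxA; congr (_ *m _).
rewrite mulmx_diag; congr diag_mx; apply/rowP => i.
by rewrite !mxE -expr2 sqrtCK.
Qed.

Lemma char_poly_eigvals A : A \is hermsymmx ->
  char_poly A = \prod_(x <- eigvals A) ('X - (x%:C)%:P).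
Proof.
move=> hA; have /hermitian_normalmx /orthomx_spectralP eA := hA.
rewrite (perm_big [seq complex.Re (spectral_diag A 0 i) | i : 'I_d]) /=;
  last by rewrite /eigvals perm_sort.
rewrite big_image /=.
have -> : char_poly A = char_poly (diag_mx (spectral_diag A)).
  have Pu := spectral_unit A.
  set Q := map_mx polyC (spectralmx A).
  set Q' := map_mx polyC (invmx (spectralmx A)).
  have Q'Q : Q' *m Q = 1%:M by rewrite -map_mxM mulVmx // map_mx1.
  rewrite /char_poly /char_poly_mx {1}eA !map_mxM /= -/Q -/Q'.
  have -> : 'X%:M - Q' *m map_mx polyC (diag_mx (spectral_diag A)) *m Q =
      Q' *m ('X%:M - map_mx polyC (diag_mx (spectral_diag A))) *m Q.
    by rewrite mulmxBr mulmxBl [Q' *m 'X%:M]scalar_mxC -['X%:M *m _ *m _]mulmxA Q'Q mulmx1.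
  by rewrite !det_mulmx mulrAC -det_mulmx Q'Q det1 mul1r.
rewrite char_poly_trig ?diag_mx_is_trig //; apply: eq_bigr => i _.
rewrite mxE eqxx mulr1n; congr ('X - _%:P).
have /mxOverP/(_ 0 i) := hermitian_spectral_diag_real hA.
by move=> /RRe_real.
Qed.

End SpectralSanity.

(* Main.v *)
Require Import Defs.
From HB Require Import structures.
From mathcomp Require Import all_boot all_order all_algebra.
From mathcomp Require Import reals.
From mathcomp Require Import complex ring zify lra.

Set Implicit Arguments.
Unset Strict Implicit.
Unset Printing Implicit Defensive.

Import Order.TTheory GRing.Theory Num.Theory.
Local Open Scope complex_scope.
Local Open Scope ring_scope.

(* Lower bound: with [S] the sum of the [X_j] and [T] the sum of their symmetric
   moduli, [2 Re <x, X y> <= <x, |X^*| x> + <y, |X| y>] is summed over the [X_j]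
   at [x = S y], where [y] is chosen so that [y] and [S y] both avoid the top
   [n - 1] eigenvectors of [T].
   Optimality: take [X_1 = u v^*] and [X_2 = e_1 e_0^* - a^2 e_2 e_2^*] with
   [u = b e_0 + a e_2], [v = b e_1 + a e_2], [a b = 1 + b^2], and let [b -> 0].
   The entry [a^2] cancels in [X_1 + X_2], while on the plane [y_2 = 0] the form
   of the symmetric moduli is [(1 + b^2)/2 |y|^2].  Two diagonal copies give
   [d = 6], and zero summands give every [m]. *)

(** * The standard inner product, kernel vectors and sums of Hermitian matrices *)

Section InnerProduct.
Local Open Scope sesquilinear_scope.
Variable R : realType.
Implicit Types d : nat.

Definition dotc d (u v : 'cV[R[i]]_d) : R[i] := (u^t* *m v) 0 0.

Lemma dotcE d (u v : 'cV[R[i]]_d) : dotc u v = \sum_k (u k 0)^* * v k 0.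
Proof. by rewrite /dotc mxE; apply: eq_bigr => k _; rewrite !mxE. Qed.

Lemma dotc_ge0 d (v : 'cV[R[i]]_d) : 0 <= dotc v v.
Proof.
by rewrite dotcE; apply: sumr_ge0 => k _; rewrite mulrC mul_conjC_ge0.
Qed.

Lemma dotc_eq0 d (v : 'cV[R[i]]_d) : (dotc v v == 0) = (v == 0).
Proof.
rewrite dotcE psumr_eq0 => [|k _]; last by rewrite mulrC mul_conjC_ge0.
apply/allP/eqP => [v0|-> k _]; last by rewrite mxE mulr0 eqxx.
apply/colP => k; rewrite mxE; apply/eqP; rewrite -mul_conjC_eq0 mulrC.
by have := v0 k (mem_index_enum _); rewrite implyTb.
Qed.

Lemma dotc_gt0 d (v : 'cV[R[i]]_d) : v != 0 -> 0 < dotc v v.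
Proof. by move=> v0; rewrite lt_def dotc_eq0 v0 dotc_ge0. Qed.

Lemma dotc_adj m n (A : 'M[R[i]]_(m, n)) u v :
  dotc u (A *m v) = dotc (A^t* *m u) v.
Proof. by rewrite /dotc trmxC_mul trmxCK mulmxA. Qed.

Lemma dotcC d (u v : 'cV[R[i]]_d) : dotc v u = (dotc u v)^*.
Proof.
rewrite !dotcE rmorph_sum; apply: eq_bigr => k _.
by rewrite rmorphM /= conjCK mulrC.
Qed.

Lemma dotcDr d (u v w : 'cV[R[i]]_d) : dotc u (v + w) = dotc u v + dotc u w.
Proof. by rewrite /dotc mulmxDr mxE. Qed.

Lemma dotcBr d (u v w : 'cV[R[i]]_d) : dotc u (v - w) = dotc u v - dotc u w.
Proof. by rewrite /dotc mulmxBr !mxE. Qed.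

Lemma dotcBl d (u v w : 'cV[R[i]]_d) : dotc (u - v) w = dotc u w - dotc v w.
Proof. by rewrite /dotc linearB map_mxB mulmxBl !mxE. Qed.

Lemma dotcZr d a (u v : 'cV[R[i]]_d) : dotc u (a *: v) = a * dotc u v.
Proof. by rewrite /dotc -scalemxAr mxE. Qed.

Lemma dotc_suml d (I : finType) (A : I -> 'M[R[i]]_d) u v :
  dotc u ((\sum_i A i) *m v) = \sum_i dotc u (A i *m v).
Proof. by rewrite /dotc mulmx_suml mulmx_sumr summxE. Qed.

Lemma psdmx_dotc d (A : 'M[R[i]]_d) v : psdmx A -> 0 <= dotc v (A *m v).
Proof. by case=> _ /(_ v); rewrite /dotc mulmxA. Qed.

(** Rank-nullity; the transposes turn the left kernel [kermx] into a right one. Every dimension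
    count below is reduced to this by stacking linear conditions as rows. *)
Lemma exists_kernel_vector m d (A : 'M[R[i]]_(m, d)) :
  (m < d)%N -> exists2 v : 'cV[R[i]]_d, v != 0 & A *m v = 0.
Proof.
move=> ltmd; have /rowV0Pn[v /sub_kermxP vA v0] : kermx A^T != 0.
  rewrite -mxrank_eq0 mxrank_ker mxrank_tr subn_eq0 -ltnNge.
  exact: leq_ltn_trans (rank_leq_row A) ltmd.
exists v^T; first by rewrite -(inj_eq (@trmx_inj _ _ _)) trmxK trmx0.
by apply: trmx_inj; rewrite trmx_mul trmxK vA trmx0.
Qed.

Lemma hermsymmxD d (A B : 'M[R[i]]_d) :
  A \is hermsymmx -> B \is hermsymmx -> A + B \is hermsymmx.
Proof.
move=> /hermsymmxP hA /hermsymmxP hB; apply/hermsymmxP.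
by rewrite linearD map_mxD hA hB.
Qed.

Lemma hermsymmx_sum d (I : finType) (A : I -> 'M[R[i]]_d) :
  (forall i, A i \is hermsymmx) -> \sum_i A i \is hermsymmx.
Proof.
move=> hA; elim/big_ind: _ => //; last exact: hermsymmxD.
by apply/hermsymmxP; rewrite trmx0 map_mx0.
Qed.

End InnerProduct.

(** * Coordinates in an orthonormal eigenbasis and counting of eigenvalues *)

Section Spectral.
Local Open Scope sesquilinear_scope.
Variables (R : realType) (d : nat).
Variable T : 'M[R[i]]_d.
Hypothesis hT : T \is hermsymmx.
Let P := spectralmx T.
Let D i := complex.Re (spectral_diag T 0 i).

Lemma spectral_diag_Re i : spectral_diag T 0 i = (D i)%:C.
Proof.
have /mxOverP/(_ 0 i) := hermitian_spectral_diag_real hT.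
by move=> /RRe_real ->.
Qed.

Lemma spectral_mulmx : P *m T = diag_mx (spectral_diag T) *m P.
Proof.
have /hermitian_normalmx/orthomx_spectralP := hT.
by rewrite -/P => {1}->; rewrite !mulmxA mulmxV ?mul1mx // spectral_unit.
Qed.

Lemma spectral_isometry u v : dotc (P *m u) (P *m v) = dotc u v.
Proof.
rewrite dotc_adj mulmxA -(invmx_unitary (spectral_unitarymx T)).
by rewrite mulVmx ?spectral_unit // mul1mx.
Qed.

Lemma spectral_quadratic v :
  dotc v (T *m v) = \sum_i (D i)%:C * (((P *m v) i 0)^* * (P *m v) i 0).
Proof.
rewrite -spectral_isometry mulmxA spectral_mulmx -mulmxA dotcE.
apply: eq_bigr => i _; rewrite -spectral_diag_Re // mul_diag_mx.
by rewrite [X in _ * X]mxE mulrCA.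
Qed.

(** The rows of [P] indexed by [J] serve as [K]: orthogonality to a set of eigenvectors becomes a
    system of [#|J|] equations, ready to be stacked with others. *)
Lemma spectral_kernel (J : {set 'I_d}) :
  exists K : 'M[R[i]]_(#|J|, d),
    forall v : 'cV_d, K *m v = 0 -> forall i, i \in J -> (P *m v) i 0 = 0.
Proof.
exists (\matrix_k row (enum_val k) P) => v Kv0 i iJ.
have /colP/(_ (enum_rank_in iJ i)) := Kv0.
rewrite !mxE => {2}<-; apply: eq_bigr => k _.
by rewrite !mxE enum_rankK_in.
Qed.

Lemma eigvals_count p : count p (eigvals T) = #|[set i | p (D i)]|.
Proof.
rewrite /eigvals count_sort count_map cardE enumT size_filter.
by apply: eq_count => i /=; rewrite inE.
Qed.

End Spectral.

(** In a nonincreasing list the entries at least [c] form an initial segment, and position [k],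
    counted from 0, lies outside it exactly when its length is at most [k]. *)
Lemma sorted_ge_nth_lt (R : realType) (s : seq R) (c : R) k :
  sorted >=%R s -> (k < size s)%N ->
  (s`_k < c) = (count (fun x => (c <= x)%R) s <= k)%N.
Proof.
elim: s k => [|x s IHs] k //= xs.
have s_le : {in s, forall y, y <= x}.
  have := xs; rewrite path_sortedE; last by move=> a b e /= h1 h2; exact: le_trans h2 h1.
  by case/andP => /allP.
case: k => [|k] /= ks.
  case: ltP => xc /=; rewrite ?add1n ?add0n //.
  rewrite leqn0 eq_sym; apply/esym/eqP.
  rewrite -(count_pred0 s); apply: eq_in_count => y /s_le yx /=.
  by rewrite leNgt (le_lt_trans yx xc).
rewrite IHs ?(path_sorted xs) //.
case: (leP c x) => cx; first by rewrite add1n ltnS.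
rewrite add0n; have -> : count (fun y => c <= y) s = 0%N; last by [].
rewrite -(count_pred0 s); apply: eq_in_count => y /s_le yx /=.
by rewrite leNgt (le_lt_trans yx cx).
Qed.

(** * The two halves of the Courant-Fischer principle *)

Section MinMax.
Local Open Scope sesquilinear_scope.
Variables (R : realType) (d : nat) (T : 'M[R[i]]_d).
Hypothesis hT : T \is hermsymmx.

(** [lambda n] reads position [n - 1] of the sorted list, so a count of at most [n - 1] becomes a
    strict bound by [n]. *)
Lemma lambda_lt_card n c : (0 < n <= d)%N ->
  (lambda n T < c) =
  (#|[set i | (c <= complex.Re (spectral_diag T 0 i))%R]| < n)%N.
Proof.
case: n => // n /= ltnd; rewrite /lambda sorted_ge_nth_lt.
- by rewrite eigvals_count.
- by apply: sort_sorted => x y; exact: le_total.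
- by rewrite size_sort size_image card_ord.
Qed.

(** [K] kills the coordinates along the fewer than [n] eigenvectors with eigenvalue at least [c];
    all remaining weights in the form are below [c]. *)
Lemma lambda_lt_form n c : (0 < n <= d)%N -> lambda n T < c ->
  exists p, exists K : 'M[R[i]]_(p, d), (p < n)%N /\
    forall v : 'cV_d, v != 0 -> K *m v = 0 -> dotc v (T *m v) < c%:C * dotc v v.
Proof.
move=> nd; rewrite lambda_lt_card // => cardJ.
have [K KJ] := spectral_kernel T [set i | c <= complex.Re (spectral_diag T 0 i)].
exists _, K; split=> // v v0 /KJ Pv0.
rewrite -(spectral_isometry T v v) spectral_quadratic // dotcE mulr_sumr.
(* A nonzero coordinate supplies the one strict term; the other terms are compared weakly. *)
have [i Pvi] : exists i, (spectralmx T *m v) i 0 != 0.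
  have : spectralmx T *m v != 0.
    by rewrite -dotc_eq0 spectral_isometry dotc_eq0.
  by case/cV0Pn => i Pvi; exists i.
have ge0 k : 0 <= ((spectralmx T *m v) k 0)^* * (spectralmx T *m v) k 0.
  by rewrite mulrC mul_conjC_ge0.
have le_c k : complex.Re (spectral_diag T 0 k) < c \/ (spectralmx T *m v) k 0 = 0.
  case: (ltP (complex.Re (spectral_diag T 0 k)) c) => [|ck]; [by left|right].
  by apply: Pv0; rewrite inE.
rewrite (bigD1 i) //= [ltRHS](bigD1 i) //= ltr_leD //.
  case: (le_c i) => [ic|/eqP]; last by rewrite (negPf Pvi).
  by rewrite ltr_pM2r ?ltcR // lt_def ge0 mulf_eq0 conjC_eq0 (negPf Pvi).
apply: ler_sum => k _.
case: (le_c k) => [kc|->]; last by rewrite !mulr0.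
by rewrite ler_wpM2r // lecR ltW.
Qed.

(** Otherwise more than [p] eigenvectors have eigenvalues beyond [c], and their span meets the
    kernel of [K] in a nonzero vector, where the form is too large. *)
Lemma lambda_le_form c p (K : 'M[R[i]]_(p, d)) : (p < d)%N ->
  (forall v : 'cV_d, K *m v = 0 -> dotc v (T *m v) <= c%:C * dotc v v) ->
  lambda p.+1 T <= c.
Proof.
move=> ltpd Kle; rewrite leNgt; apply/negP => ltc.
(* A threshold strictly above [c] is needed: with [c] itself the two bounds on the form would not
   contradict each other. *)
have [c' /andP[cc' ltc']] : exists c', c < c' < lambda p.+1 T.
  by exists ((c + lambda p.+1 T) / 2); rewrite !(midf_lt ltc).
set J := [set i | c' <= complex.Re (spectral_diag T 0 i)].
have ltJ : (p < #|J|)%N.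
  by rewrite ltnNge -ltnS -lambda_lt_card // -leNgt ltW.
have [L LJ] := spectral_kernel T (~: J).
have ltd : (p + #|~: J| < d)%N.
  by rewrite -[ltnRHS](card_ord d) -(cardsC J) ltn_add2r.
have [v v0] := exists_kernel_vector (col_mx K L) ltd.
rewrite mul_col_mx -col_mx0 => /eq_col_mx[/Kle + /LJ Pv0].
move=> le_c; have : c'%:C * dotc v v <= c%:C * dotc v v.
  apply: le_trans le_c.
  rewrite -(spectral_isometry T v v) spectral_quadratic // dotcE mulr_sumr.
  apply: ler_sum => k _.
  have [|nJk] := boolP (k \in J); last by rewrite Pv0 ?mulr0 ?in_setC.
  by rewrite inE => Jk; rewrite ler_wpM2r ?lecR // mulrC mul_conjC_ge0.
by rewrite ler_pM2r ?lecR ?dotc_gt0 // leNgt cc'.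
Qed.

End MinMax.

(** * Uniqueness of the positive square root and the polarization inequality *)

Section SquareRoot.
Local Open Scope sesquilinear_scope.
Variables (R : realType) (d : nat).
Implicit Types A B X : 'M[R[i]]_d.

(* Conjugating by the two eigenbases turns [A^2 = B^2] into
   [d_i^2 w_ij = w_ij e_j^2] with [d_i, e_j >= 0], whence [d_i w_ij = w_ij e_j]. *)
Lemma psdmx_sqr_inj A B : psdmx A -> psdmx B -> A *m A = B *m B -> A = B.
Proof.
move=> pA pB AB.
have eA := spectral_mulmx (proj1 pA); have eB := spectral_mulmx (proj1 pB).
move: (fun i => spectral_diag_psd i pA) (fun i => spectral_diag_psd i pB).
move: (spectral_unit A) (spectral_unit B) eA eB.
move: (spectralmx A) (spectral_diag A) (spectralmx B) (spectral_diag B).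
move=> P D Q E uP uQ eA eB D0 E0.
have eB' : B *m invmx Q = invmx Q *m diag_mx E.
  by apply: (can_inj (mulKmx uQ)); rewrite mulmxA eB mulmxK // mulKVmx.
set W := P *m invmx Q.
have DW : diag_mx D *m W = W *m diag_mx E.
  have DDW : diag_mx D *m (diag_mx D *m W) = W *m diag_mx E *m diag_mx E.
    have -> : diag_mx D *m (diag_mx D *m W) = P *m (A *m A) *m invmx Q.
      by rewrite !mulmxA eA -[in RHS](mulmxA _ P) eA !mulmxA.
    by rewrite AB mulmxA -2!mulmxA eB' (mulmxA B) eB' !mulmxA.
  move: W DDW => W DDW; apply/matrixP => i j; have /matrixP/(_ i j) := DDW.
  rewrite !mul_diag_mx !mul_mx_diag !mxE => e.
  (* A nonzero entry cancels, and squaring is injective on nonnegative numbers. *)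
  have [->|w0] := eqVneq (W i j) 0; first by rewrite mulr0 mul0r.
  rewrite mulrC; congr (_ * _); apply/eqP.
  rewrite -(@eqrXn2 _ 2) // !expr2; apply/eqP/(mulfI w0).
  by rewrite [LHS]mulrC -[LHS]mulrA e mulrA.
have : P *m A *m invmx Q = P *m B *m invmx Q.
  by rewrite eA -[LHS]mulmxA -/W DW -[RHS]mulmxA eB' mulmxA.
have Qi : invmx Q \in unitmx by rewrite unitmx_inv.
by move/(can_inj (mulmxK Qi))/(can_inj (mulKmx uP)).
Qed.

(** Frees later computations from [spectralmx]: a modulus is identified by squaring a positive
    semidefinite candidate. *)
Lemma sqrtmx_uniq A B : psdmx B -> B *m B = A -> sqrtmx A = B.
Proof.
move=> pB AB; have pA : psdmx A.
  by rewrite -AB -{1}(hermsymmxP _ (proj1 pB)); exact: psdmx_gram.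
apply: (psdmx_sqr_inj (sqrtmx_psd pA) pB).
by rewrite (sqrtmxK pA).
Qed.

Lemma hermsymmx_modulus X : modulus X \is hermsymmx.
Proof. by case: (sqrtmx_psd (psdmx_gram X)). Qed.

Lemma psdmx_modulus X : psdmx (modulus X).
Proof. exact/sqrtmx_psd/psdmx_gram. Qed.

Lemma modulus_uniq X B : psdmx B -> B *m B = X^t* *m X -> modulus X = B.
Proof. exact: sqrtmx_uniq. Qed.

Lemma hermsymmx_sym_modulus X : sym_modulus X \is hermsymmx.
Proof.
have /hermsymmxP e : modulus X + modulus (X^t*) \is hermsymmx.
  by apply: hermsymmxD; exact: hermsymmx_modulus.
 apply/hermsymmxP.
by rewrite /sym_modulus linearZ map_mxZ /= e fmorphV /= conjC_nat.
Qed.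

Lemma psdmx_gram_diag m (P : 'M[R[i]]_(m, d)) (D : 'rV_m) :
  (forall i, 0 <= D 0 i) -> psdmx (P^t* *m diag_mx D *m P).
Proof.
move=> D0; split=> [|v]; last exact: gram_ge0.
apply/hermsymmxP; rewrite !trmxC_mul trmxCK mulmxA; congr (_ *m _ *m _).
rewrite tr_diag_mx map_diag_mx; congr diag_mx; apply/rowP => i; rewrite mxE.
exact/CrealP/ger0_real.
Qed.

Lemma dotc_gram_diag m (P : 'M[R[i]]_(m, d)) (D : 'rV_m) v :
  dotc v (P^t* *m diag_mx D *m P *m v) =
    \sum_i D 0 i * (((P *m v) i 0)^* * (P *m v) i 0).
Proof.
rewrite -!mulmxA dotc_adj trmxCK dotcE; apply: eq_bigr => i _.
by rewrite mul_diag_mx [X in _ * X]mxE mulrCA.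
Qed.

(* With [X^* X = P^* diag(a)^2 P], the columns of [X P^*] are orthogonal with
   norms [a_i]; in this basis the inequality is AM-GM, term by term. *)
Lemma modulus_polarization X x y :
  dotc x (X *m y) + dotc (X *m y) x <=
    dotc x (modulus (X^t*) *m x) + dotc y (modulus X *m y).
Proof.
set G := X^t* *m X; set P := spectralmx G.
set a := map_mx sqrtC (spectral_diag G).
have uP := spectral_unit G; have iP := invmx_unitary (spectral_unitarymx G).
have a0 i : 0 <= a 0 i by rewrite mxE sqrtC_ge0 spectral_diag_psd //; exact: psdmx_gram.
set Y := X *m P^t*.
have XE : X = Y *m P by rewrite -mulmxA -iP mulVmx // mulmx1.
have PP : P *m P^t* = 1%:M by rewrite -iP mulmxV.
have YY : Y^t* *m Y = diag_mx a *m diag_mx a.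
  rewrite trmxC_mul trmxCK !mulmxA -[P *m _ *m X]mulmxA.
  rewrite spectral_mulmx; last by case: (psdmx_gram X).
  rewrite -mulmxA PP mulmx1 mulmx_diag; congr diag_mx; apply/rowP => i.
  by rewrite !mxE -expr2 sqrtCK.
have mX : modulus X = P^t* *m diag_mx a *m P.
  rewrite -iP.
  reflexivity.
clearbody a Y.
(* The squared norm of column [i] of [Y] is [a_i^2], a diagonal entry of [YY]. *)
have Y0 i k : a 0 i = 0 -> Y k i = 0.
  move=> ai; have /matrixP/(_ i i) := YY.
  rewrite mul_diag_mx !mxE ai mul0r => /eqP.
  rewrite psumr_eq0 => [/allP/(_ k (mem_index_enum _))|l _]; last first.
    by rewrite !mxE mulrC mul_conjC_ge0.
  by rewrite !mxE mulrC mul_conjC_eq0 => /eqP.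
(* [|X^*|] is [Y diag(1/a) Y^*]. Where [a_i = 0] the inverse is 0 by convention, which is harmless
   since column [i] of [Y] vanishes. *)
set b : 'rV_d := \row_i (a 0 i)^-1.
have b0 i : 0 <= b 0 i by rewrite mxE invr_ge0.
have mX' : modulus (X^t*) = Y^t*^t* *m diag_mx b *m Y^t*.
  apply: modulus_uniq; first exact: psdmx_gram_diag.
  rewrite !trmxCK XE trmxC_mul mulmxA -[_ *m P *m _]mulmxA PP mulmx1.
  rewrite !mulmxA -[_ *m Y^t* *m Y]mulmxA YY; congr (_ *m _).
  apply/matrixP => k i; rewrite !mulmxA !mul_mx_diag !mxE.
  have [ai0|ai0] := eqVneq (a 0 i) 0; last by rewrite mulfVK // mulfK.
  by rewrite (Y0 i k ai0) !mul0r.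
have xXy : dotc x (X *m y) = dotc (Y^t* *m x) (P *m y).
  by rewrite XE -mulmxA dotc_adj.
rewrite [dotc _ x]dotcC xXy -dotcC mX mX' !dotc_gram_diag.
rewrite !dotcE -!big_split; apply: ler_sum => i _ /=.
have s0 : a 0 i = 0 -> (Y^t* *m x) i 0 = 0.
  move=> ai; rewrite mxE big1 // => k _.
  by rewrite !mxE Y0 // conjC0 mul0r.
rewrite [b 0 i]mxE.
move: (a 0 i) ((Y^t* *m x) i 0) (a0 i) s0 ((P *m y) i 0) => c s c0 s0 t.
(* For [c = 0] the cross terms vanish with [s]; otherwise right side minus left side is
   [|s - c t|^2 / c]. *)
have [/s0 ->|cn0] := eqVneq c 0.
  by rewrite !(conjC0, mulr0, mul0r, add0r) mulr_ge0 // mulrC mul_conjC_ge0.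
have : 0 <= c^-1 * ((s - c * t) * (s - c * t)^*).
  by rewrite mulr_ge0 ?invr_ge0 // mul_conjC_ge0.
rewrite -subr_ge0; congr (_ <= _).
rewrite rmorphB rmorphM /= (CrealP (ger0_real c0)).
by field.
Qed.
End SquareRoot.

(** * The lower bound [1/2] *)

Section Bound.
Local Open Scope sesquilinear_scope.
Variables (R : realType) (d : nat).
Implicit Types A B S X : 'M[R[i]]_d.

(** With [A = |S|], the vectors [S v] and [A v] have equal norms, and [|A v|^2 - |v|^2 = |A v - v|^2
    + 2 (<v, A v> - |v|^2)], where both terms are nonnegative. *)
Lemma modulus_ge1 S v : loewner_le 1%:M (modulus S) -> dotc v v <= dotc (S *m v) (S *m v).
Proof.
move=> S1; set A := modulus S.
have hA : A^t* = A by exact/hermsymmxP/hermsymmx_modulus.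
have AA : A *m A = S^t* *m S by exact/sqrtmxK/psdmx_gram.
have le1 w : dotc w w <= dotc w (A *m w).
  by have := psdmx_dotc w S1; rewrite mulmxBl mul1mx dotcBr subr_ge0.
clearbody A; clear S1.
have -> : dotc (S *m v) (S *m v) = dotc (A *m v) (A *m v).
  by rewrite [LHS]dotc_adj [RHS]dotc_adj hA !mulmxA AA.
have : 0 <= dotc (A *m v - v) (A *m v - v) + 2 * (dotc v (A *m v) - dotc v v).
  by rewrite addr_ge0 ?dotc_ge0 // mulr_ge0 // subr_ge0.
move=> ge0; rewrite -subr_ge0; move: ge0; congr (_ <= _).
rewrite dotcBr !dotcBl [dotc v (A *m v)]dotc_adj hA.
by ring.
Qed.

(** The missing terms [<x, |X| x>] and [<y, |X^*| y>] are nonnegative. Adding them puts the same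
    matrix at [x] and at [y], so that the sum over the [X_j] involves only [T]. *)
Lemma sym_modulus_polarization X x y :
  dotc x (X *m y) + dotc (X *m y) x <=
    2 * (dotc x (sym_modulus X *m x) + dotc y (sym_modulus X *m y)).
Proof.
apply: le_trans (modulus_polarization X x y) _.
rewrite /sym_modulus -!scalemxAl !dotcZr !mulmxDl !dotcDr.
rewrite -mulrDr mulVKf ?pnatr_eq0 // [_ + dotc x (modulus (X^t*) *m x)]addrC.
apply: lerD; first by rewrite lerDl psdmx_dotc //; exact: psdmx_modulus.
by rewrite lerDl psdmx_dotc //; exact: psdmx_modulus.
Qed.

End Bound.

(* [y] and [S y] satisfy [n - 1] linear conditions each, and [2 (n - 1) < d];
   then [2 |S y|^2 < |S y|^2 + |y|^2 <= 2 |S y|^2]. *)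
Lemma lambda_sum_sym_modulus (R : realType) (m d n : nat) (X : 'I_m -> 'M[R[i]]_d) :
  (0 < n)%N -> (2 * n - 1 <= d)%N ->
  loewner_le 1%:M (modulus (\sum_(j < m) X j)) ->
  1 / 2 <= lambda n (\sum_(j < m) sym_modulus (X j)).
Proof.
move=> n0 nd; set S := \sum_j X j => S1; set T := \sum_j _.
have hT : T \is hermsymmx by apply: hermsymmx_sum => j; exact: hermsymmx_sym_modulus.
rewrite leNgt; apply/negP => /(lambda_lt_form hT)[|p [K [ltpn KT]]].
  by rewrite n0; lia.
have [y y0] := @exists_kernel_vector _ (p + p) d (col_mx K (K *m S)) ltac:(lia).
rewrite mul_col_mx -col_mx0 -mulmxA => /eq_col_mx[Ky KSy].
have yx := modulus_ge1 y S1.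
have x0 : S *m y != 0.
  rewrite -dotc_eq0; apply: contraTneq yx => ->.
  by rewrite lt_geF // dotc_gt0.
have [x Sx] : exists x, S *m y = x by exists (S *m y).
rewrite Sx in yx x0 KSy.
have pol : dotc x x + dotc x x <= 2 * (dotc x (T *m x) + dotc y (T *m y)).
  (* Only the inner two of the four [x] are expanded, giving [<x, S y> + <S y, x>], which splits
     over the summands of [S]. *)
  rewrite -{2 3}Sx [dotc (_ *m _) x]dotcC !dotc_suml rmorph_sum -big_split.
  rewrite -big_split mulr_sumr; apply: ler_sum => j _ /=.
  by rewrite -dotcC sym_modulus_polarization.
have half : (1 / 2)%:C = 2^-1 :> R[i] by rewrite div1r fmorphV rmorph_nat.
have lt1 := ltrD (KT _ x0 KSy) (KT _ y0 Ky).
have le2 : dotc x x + dotc y y <= dotc x x + dotc x x by rewrite lerD2l.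
have := lt_le_trans (le_lt_trans pol _) le2.
rewrite -ltr_pdivlMl ?ltr0n // -half mulrDr => /(_ lt1).
by rewrite ltxx.
Qed.

(** * Explicit moduli, direct sums and zero padding for the optimality examples *)

Section Moduli.
Local Open Scope sesquilinear_scope.
Variable R : realType.
Implicit Types d m n : nat.

Lemma psdmx_diag d (D : 'rV[R[i]]_d) :
  (forall i, 0 <= D 0 i) -> psdmx (diag_mx D).
Proof.
move=> D0; have := psdmx_gram_diag 1%:M D0.
by rewrite mulmx1 trmx1 map_mx1 mul1mx.
Qed.

Lemma modulus0 d : modulus (0 : 'M[R[i]]_d) = 0.
Proof.
apply: modulus_uniq; last by rewrite !mulmx0.
by have := @psdmx_gram R d 0; rewrite mulmx0.
Qed.

Lemma sym_modulus0 d : sym_modulus (0 : 'M[R[i]]_d) = 0.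
Proof. by rewrite /sym_modulus trmx0 map_mx0 modulus0 addr0 scaler0. Qed.

(** Both squares are multiples of [v v^*], by [|u|^2] and by [|v|^2]; equal norms spare any
    normalization. *)
Lemma modulus_rank1 d (u v : 'cV[R[i]]_d) :
  dotc u u = dotc v v -> modulus (u *m v^t*) = v *m v^t*.
Proof.
move=> uv; apply: modulus_uniq.
  have := @psdmx_gram_diag R d 1 (v^t*) (const_mx 1); rewrite trmxCK diag_const_mx mulmx1.
  by apply => i; rewrite mxE ler01.
have dotM (w : 'cV[R[i]]_d) : w^t* *m w = (dotc w w)%:M.
  by apply/matrixP => i j; rewrite !ord1 [RHS]mxE.
rewrite trmxC_mul trmxCK !mulmxA -[_ *m _ *m v]mulmxA -[_ *m _ *m u]mulmxA.
by rewrite !dotM uv.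
Qed.

(** Testing the hypothesis on the eigenvectors of [S^* S] shows its eigenvalues to be at least 1,
    hence also their square roots. *)
Lemma loewner_le1_modulus d (S : 'M[R[i]]_d) :
  (forall v, dotc v v <= dotc (S *m v) (S *m v)) ->
  loewner_le 1%:M (modulus S).
Proof.
move=> S1; rewrite /loewner_le /modulus /sqrtmx.
set G := S^t* *m S; have hG : G \is hermsymmx by case: (psdmx_gram S).
have uP := spectral_unit G; have iP := invmx_unitary (spectral_unitarymx G).
have GP := spectral_mulmx hG.
have D1 i : 1 <= spectral_diag G 0 i.
  have PK : spectralmx G *m (spectralmx G)^t* = 1%:M by rewrite -iP mulmxV.
  have := S1 ((spectralmx G)^t* *m delta_mx i 0).
  set p := _ *m _; have Pp : spectralmx G *m p = delta_mx i 0.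
    by rewrite mulmxA PK mul1mx.
  have -> : dotc (S *m p) (S *m p) = dotc p (G *m p).
    by rewrite -mulmxA [RHS]dotc_adj trmxCK.
  rewrite spectral_quadratic // -(spectral_isometry G) !Pp dotcE.
  have delta k : ((delta_mx i 0 : 'cV[R[i]]_d) k 0)^* * delta_mx i 0 k 0 = (k == i)%:R.
    by rewrite !mxE eqxx andbT conjC_nat -natrM mulnb andbb.
  under eq_bigr do rewrite delta.
  under [leRHS]eq_bigr do rewrite delta -spectral_diag_Re //.
  rewrite (bigD1 i) //= big1 => [|k /negPf->] //.
  by rewrite (bigD1 i) //= big1 => [|k /negPf->]; rewrite ?mulr0 // eqxx mulr1 !addr0.
set a := map_mx sqrtC _.
have -> : invmx (spectralmx G) *m diag_mx a *m spectralmx G - 1%:M =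
    (spectralmx G)^t* *m diag_mx (a - const_mx 1) *m spectralmx G.
  by rewrite linearB /= diag_const_mx mulmxBr mulmxBl mulmx1 -iP mulVmx.
apply: psdmx_gram_diag => i; rewrite !mxE subr_ge0.
by rewrite -[X in X <= _]sqrtC1 ler_sqrtC // qualifE /= ?ler01 // (le_trans ler01).
Qed.

(** A certificate in terms of forms: the first clause yields [|X + Y| >= I], the second
    [lambda p.+1 <= r] by min-max. In this shape it passes to direct sums without any eigenvalue
    computation. *)
Definition two_summand_example d p (r : R) : Prop :=
  exists X Y : 'M[R[i]]_d,
    (forall v, dotc v v <= dotc ((X + Y) *m v) ((X + Y) *m v)) /\
    exists K : 'M[R[i]]_(p, d), forall v : 'cV_d, K *m v = 0 ->
      dotc v ((sym_modulus X + sym_modulus Y) *m v) <= r%:C * dotc v v.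

Lemma dotc_col_mx m n (u1 v1 : 'cV[R[i]]_m) (u2 v2 : 'cV[R[i]]_n) :
  dotc (col_mx u1 u2) (col_mx v1 v2) = dotc u1 v1 + dotc u2 v2.
Proof. by rewrite /dotc tr_col_mx map_row_mx mul_row_col mxE. Qed.

Lemma mul_block_diag_col m n p q (A : 'M[R[i]]_(m, n)) (B : 'M_(p, q))
    (u : 'cV_n) (v : 'cV_q) :
  block_mx A 0 0 B *m col_mx u v = col_mx (A *m u) (B *m v).
Proof. by rewrite mul_block_col !mul0mx addr0 add0r. Qed.

Lemma trmxC_block_diag m n p q (A : 'M[R[i]]_(m, n)) (B : 'M_(p, q)) :
  (block_mx A 0 0 B)^t* = block_mx (A^t*) 0 0 (B^t*).
Proof. by rewrite tr_block_mx map_block_mx !trmx0 !map_mx0. Qed.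

Lemma psdmx_block_diag m n (A : 'M[R[i]]_m) (B : 'M_n) :
  psdmx A -> psdmx B -> psdmx (block_mx A 0 0 B).
Proof.
move=> pA pB; have [/hermsymmxP hA _] := pA; have [/hermsymmxP hB _] := pB.
split=> [|v]; first by apply/hermsymmxP; rewrite trmxC_block_diag hA hB.
rewrite -mulmxA -[_ 0 0]/(dotc v _) -[v]vsubmxK mul_block_diag_col dotc_col_mx.
by rewrite addr_ge0 // psdmx_dotc.
Qed.

Lemma modulus_block_diag m n (A : 'M[R[i]]_m) (B : 'M_n) :
  modulus (block_mx A 0 0 B) = block_mx (modulus A) 0 0 (modulus B).
Proof.
apply: modulus_uniq; first by apply: psdmx_block_diag; exact: psdmx_modulus.
rewrite trmxC_block_diag !mulmx_block !mulmx0 !mul0mx !addr0 !add0r.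
by congr block_mx; exact/sqrtmxK/psdmx_gram.
Qed.

Lemma sym_modulus_block_diag m n (A : 'M[R[i]]_m) (B : 'M_n) :
  sym_modulus (block_mx A 0 0 B) = block_mx (sym_modulus A) 0 0 (sym_modulus B).
Proof.
rewrite /sym_modulus trmxC_block_diag !modulus_block_diag add_block_mx !addr0.
by rewrite scale_block_mx !scaler0.
Qed.

(** Two diagonal copies double the number of conditions too: from [d = 3], [p = 1] to [d = 6],
    [p = 2], which controls the third eigenvalue. *)
Lemma two_summand_example_double d p r :
  two_summand_example d p r -> two_summand_example (d + d) (p + p) r.
Proof.
move=> [X [Y [XY1 [K Kr]]]].
exists (block_mx X 0 0 X), (block_mx Y 0 0 Y); split=> [v|].
  rewrite -[v]vsubmxK add_block_mx !addr0 mul_block_diag_col !dotc_col_mx.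
  by rewrite lerD.
exists (block_mx K 0 0 K) => v; rewrite -[v]vsubmxK mul_block_diag_col -col_mx0.
move=> /eq_col_mx[/Kr Ku /Kr Kd]; rewrite !sym_modulus_block_diag add_block_mx !addr0.
by rewrite mul_block_diag_col !dotc_col_mx mulrDr lerD.
Qed.

Lemma two_summand_example_lambda d p r m : (p < d)%N -> (2 <= m)%N ->
  two_summand_example d p r ->
  exists X : 'I_m -> 'M[R[i]]_d,
    loewner_le 1%:M (modulus (\sum_(j < m) X j)) /\
    lambda p.+1 (\sum_(j < m) sym_modulus (X j)) <= r.
Proof.
move=> ltpd; case: m => [|[|m]] // _ [X [Y [XY1 [K Kr]]]].
(* The default value of [nth] makes every summand after the second zero. *)
pose Z (j : 'I_m.+2) := nth 0 [:: X; Y] j.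
have sumZ (f : 'M[R[i]]_d -> 'M[R[i]]_d) : f 0 = 0 -> \sum_j f (Z j) = f X + f Y.
  move=> f0; rewrite !big_ord_recl big1 => [|j _]; first by rewrite addr0.
  by rewrite /Z /= nth_nil.
exists Z; split; first by apply: loewner_le1_modulus; rewrite (sumZ id).
apply: (lambda_le_form _ ltpd (K := K)).
  by apply: hermsymmx_sum => j; exact: hermsymmx_sym_modulus.
by move=> v Kv0; rewrite (sumZ (@sym_modulus R d)) ?sym_modulus0 // Kr.
Qed.

End Moduli.

(** * The three-dimensional example *)

Section Example.
Local Open Scope sesquilinear_scope.
Variable R : realType.

Lemma conjC_real_complex (x : R) : (x%:C)^* = x%:C.
Proof. by apply/CrealP/complex_realP; exists x. Qed.

Lemma sum_ord3 (F : 'I_3 -> R[i]) : \sum_i F i = F 0 + F 1 + F 2.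
Proof.
rewrite !big_ord_recl big_ord0 addr0 addrA.
by congr (F _ + F _ + F _); apply: val_inj.
Qed.

Lemma dotc_rank1 d (v y : 'cV[R[i]]_d) :
  dotc y (v *m v^t* *m y) = dotc v y * (dotc v y)^*.
Proof.
have vy : v^t* *m y = (dotc v y)%:M.
  by apply/matrixP => i j; rewrite !ord1 [RHS]mxE.
by rewrite -mulmxA vy mul_mx_scalar dotcZr [dotc y v]dotcC.
Qed.

Lemma trmxC_real m n (A : 'M[R]_(m, n)) :
  (map_mx (real_complex R) A)^t* = map_mx (real_complex R) A^T.
Proof. by apply/matrixP => i j; rewrite !mxE /= conjC_real_complex. Qed.

(** Moves the verification to real matrices, where it is a [ring] identity in each entry. *)
Lemma modulus_real_diag d (A : 'M[R]_d) (D : 'rV_d) :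
  (forall i, 0 <= D 0 i) -> A^T *m A = diag_mx D *m diag_mx D ->
  modulus (map_mx (real_complex R) A) = diag_mx (map_mx (real_complex R) D).
Proof.
move=> D0 AD; apply: modulus_uniq.
  by apply: psdmx_diag => i; rewrite mxE lecR.
by rewrite trmxC_real -map_diag_mx -!map_mxM AD.
Qed.

Lemma dotc3 (u v : 'cV[R[i]]_3) :
  dotc u v = (u 0 0)^* * v 0 0 + (u 1 0)^* * v 1 0 + (u 2 0)^* * v 2 0.
Proof. by rewrite dotcE sum_ord3. Qed.

Lemma two_summand_example3 (a b : R) : a * b = 1 + b ^+ 2 ->
  two_summand_example 3 1 ((1 + b ^+ 2) / 2).
Proof.
move=> ab.
pose u0 : 'cV[R]_3 := \col_i nth 0 [:: b; 0; a] i.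
pose v0 : 'cV[R]_3 := \col_i nth 0 [:: 0; b; a] i.
pose u := map_mx (real_complex R) u0; pose v := map_mx (real_complex R) v0.
pose Y : 'M[R]_3 :=
  \matrix_(i, j) nth 0 (nth [::] [:: [:: 0; 0; 0]; [:: 1; 0; 0]; [:: 0; 0; - a ^+ 2]] i) j.
pose D1 : 'rV[R]_3 := \row_j nth 0 [:: 1; 0; a ^+ 2] j.
pose D2 : 'rV[R]_3 := \row_j nth 0 [:: 0; 1; a ^+ 2] j.
have uv : dotc u u = dotc v v.
  rewrite !dotc3 !mxE /= !conjC_real_complex.
  by ring.
have mY : modulus (map_mx (real_complex R) Y) = diag_mx (map_mx (real_complex R) D1).
  apply: modulus_real_diag.
    by case=> [[|[|[|k]]] lek] //; rewrite mxE //= ?ler01 // sqr_ge0.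
  by apply/matrixP => -[[|[|[|i]]] lei] [[|[|[|j]]] lej] //;
    rewrite mul_diag_mx !mxE !big_ord_recl big_ord0 !mxE /=; ring.
have mY' : modulus ((map_mx (real_complex R) Y)^t*) = diag_mx (map_mx (real_complex R) D2).
  rewrite trmxC_real; apply: modulus_real_diag.
    by case=> [[|[|[|k]]] lek] //; rewrite mxE //= ?ler01 // sqr_ge0.
  by apply/matrixP => -[[|[|[|i]]] lei] [[|[|[|j]]] lej] //;
    rewrite mul_diag_mx !mxE !big_ord_recl big_ord0 !mxE /=; ring.
exists (u *m v^t*), (map_mx (real_complex R) Y); split=> [w|].
  (* The sum [u v^* + Y], with the corner entry [a^2] cancelled. *)
  pose S : 'M[R]_3 := \matrix_(i, j)
    nth 0 (nth [::] [:: [:: 0; b ^+ 2; a * b]; [:: 1; 0; 0]; [:: 0; a * b; 0]] i) j.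
  have -> : u *m v^t* + map_mx (real_complex R) Y = map_mx (real_complex R) S.
    rewrite trmxC_real -map_mxM -map_mxD; congr map_mx.
    by apply/matrixP => -[[|[|[|i]]] lei] [[|[|[|j]]] lej] //;
      rewrite !mxE big_ord1 !mxE /=; ring.
  rewrite !dotc3 !mxE !sum_ord3 !mxE /= ab.
  have b0 : 0 <= (b ^+ 2)%:C by rewrite lecR sqr_ge0.
  have -> : (1 + b ^+ 2)%:C = 1 + (b ^+ 2)%:C :> R[i] by rewrite rmorphD rmorph1.
  rewrite !(rmorph0, rmorph1).
  move: (b ^+ 2)%:C b0 (conjC_real_complex (b ^+ 2)) (w 0 0) (w 1 0) (w 2 0).
  move=> B B0 BJ x y z.
  rewrite !mul0r !add0r !mul1r !addr0 !(rmorphD, rmorphM) /= rmorph1 BJ.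
  (* With [a b = 1 + B], the difference [|S w|^2 - |w|^2] is an explicit sum of squares with
     nonnegative weights. *)
  rewrite -subr_ge0 (_ : _ - _ = B * (1 + B) * ((y + z) * (y + z)^*) +
    B * (1 + B) * (y * y^*) + B * (z * z^*)); last first.
    by rewrite rmorphD /=; ring.
  by rewrite !(addr_ge0, mul_conjC_ge0, mulr_ge0, ler01).
(* The single condition [y_2 = 0] removes every term containing [a]. The rank-one moduli then
   contribute [b^2] and the diagonal ones 1 on each remaining coordinate, so the bound is an
   equality. *)
exists (\row_j (j == 2)%:R) => y /colP/(_ 0); rewrite !mxE sum_ord3 !mxE /=.
rewrite !mul0r !add0r mul1r => y2.
rewrite /sym_modulus mY mY' trmxC_mul trmxCK !modulus_rank1 //.
rewrite mulmxDl -!scalemxAl !mulmxDl dotcDr !dotcZr !dotcDr !dotc_rank1.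
rewrite !dotc3 !mul_diag_mx y2 !mxE /=.
rewrite y2 !(rmorph0, rmorph1) !mulr0 !addr0.
have -> : ((1 + b ^+ 2) / 2)%:C = (1 + b%:C ^+ 2) / 2 :> R[i].
  by rewrite fmorph_div rmorphD rmorph1 rmorphXn rmorph_nat.
move: b%:C (conjC_real_complex b) (y 0 0) (y 1 0) => B BJ s t.
rewrite !mul0r !add0r !addr0 !rmorphM /= !BJ le_eqVlt; apply/orP; left; apply/eqP.
by field.
Qed.

End Example.

Theorem theorem3p1 (R : realType) :
  (forall (m d n : nat) (X : 'I_m -> 'M[R[i]]_d),
     (2 <= m)%N -> (2 <= d)%N ->
     d = (2 * n - 1)%N \/ d = (2 * n)%N ->
     loewner_le 1%:M (modulus (\sum_(j < m) X j)) ->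
     1 / 2 <= lambda n (\sum_(j < m) sym_modulus (X j)))
  /\
  (forall (d n m : nat) (c : R),
     (d, n) = (3, 2)%N \/ (d, n) = (6, 3)%N ->
     (2 <= m)%N -> 1 / 2 < c ->
     exists X : 'I_m -> 'M[R[i]]_d,
       loewner_le 1%:M (modulus (\sum_(j < m) X j)) /\
       lambda n (\sum_(j < m) sym_modulus (X j)) < c).
Proof.
split=> [m d n X _ d2 dn|d n m c dn m2 c2].
  (* Both values of [d] give [2 n - 1 <= d], and [d >= 2] forces [n > 0]. *)
  by apply: lambda_sum_sym_modulus; lia.
(* Then [b^2 <= b <= c - 1/2], so [(1 + b^2)/2 <= 1/2 + b/2 < c]. *)
pose b := Num.min 1 (c - 1 / 2).
have b0 : 0 < b by rewrite lt_min ltr01 subr_gt0.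
have r_lt : (1 + b ^+ 2) / 2 < c.
  have b_le1 : b <= 1 by rewrite ge_min lexx.
  have b_lec : b <= c - 1 / 2 by rewrite ge_min lexx orbT.
  by nra.
have ex : two_summand_example 3 1 ((1 + b ^+ 2) / 2).
  (* The value of [a] is dictated by [a b = 1 + b^2]. *)
  by apply: (@two_summand_example3 _ ((1 + b ^+ 2) / b)); rewrite divfK ?gt_eqF.
have [X [X1 lamX]] : exists X : 'I_m -> 'M[R[i]]_d,
    loewner_le 1%:M (modulus (\sum_(j < m) X j)) /\
    lambda n (\sum_(j < m) sym_modulus (X j)) <= (1 + b ^+ 2) / 2.
  case: dn => -[-> ->]; first exact: two_summand_example_lambda ex.
  exact: two_summand_example_lambda (two_summand_example_double ex).
by exists X; split; last exact: le_lt_trans lamX r_lt.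
Qed.
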